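(* Let $A_0$ be a unital $C^*$-algebra and $\mathcal A_0\subseteq A_0$ a norm-dense unital $*$-subalgebra. Let $X$ be a right Hilbert $C^*$-module over $A_0$ with norm $\|\cdot\|$, and let $\mathcal X\subseteq X$ be a norm-dense subspace with $\mathcal X\cdot\mathcal A_0\subseteq\mathcal X$ and $\langle\mathcal X,\mathcal X\rangle\subseteq\mathcal A_0$. Let $L:\mathcal X\to[0,\infty)$ be a seminorm and $L_0:\mathcal A_0\to[0,\infty)$ a slip-norm such that $(\mathcal A_0,L_0)$ is a compact quantum metric space. Suppose that $\mathcal X$ has a finite frame $\zeta_1,\dots,\zeta_n$ such that (1) there is a constant $C\ge0$ with $\|x\|\le C\cdot L(x)$ for all $x\in\mathcal X$; (2) there is a constant $C_0\ge 0$ with $L_0(\langle\zeta_j,x\rangle)\le C_0\cdot(L(x)+\|x\|)$ for all $x\in\mathcal X$ and $j\in\{1,\dots,n\}$. Then the set $\{x\in\mathcal X:L(x)\le1\}$ is totally bounded in $X$.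
   Context: A finite frame for $\mathcal X$ is a finite family $\zeta_1,\dots,\zeta_n\in\mathcal X$ with $\sum_{j=1}^n\zeta_j\cdot\langle\zeta_j,x\rangle=x$ for all $x\in\mathcal X$. A slip-norm on an operator system $\mathcal E$ (a subspace of a unital $C^*$-algebra containing $1$ and closed under adjoints) is a seminorm $L$ with $L(1)=0$, $L(x^* )=L(x)$; $(\mathcal E,L)$ is a compact quantum metric space if the metric $d_L(\mu,\nu)=\sup\{|\mu(x)-\nu(x)|:L(x)\le 1\}$ on the state space of $\mathcal E$ induces the weak$^*$ topology. *)

(* Defs.v *)
From HB Require Import structures.
From mathcomp Require Import all_boot all_order all_algebra.
From mathcomp Require Import complex.
From mathcomp Require Import classical_sets reals constructive_ereal ereal.
Set Implicit Arguments. Unset Strict Implicit. Unset Printing Implicit Defensive.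
Import Order.TTheory GRing.Theory Num.Theory.
Local Open Scope ring_scope.
Local Open Scope classical_set_scope.

Section CStar.
Variable R : realType.
Local Notation C := (R[i]).

Definition cabs (z : C) : R := Normc.normc z.

Definition is_complete {V : zmodType} (nrm : V -> R) : Prop :=
  forall u : nat -> V,
    (forall e : R, 0 < e -> exists N, forall m n, (N <= m)%N -> (N <= n)%N ->
        nrm (u m - u n) < e) ->
    exists a : V, forall e : R, 0 < e -> exists N, forall n, (N <= n)%N ->
        nrm (u n - a) < e.

Definition is_dense {V : zmodType} (nrm : V -> R) (P : set V) : Prop :=
  forall (v : V) (e : R), 0 < e -> exists2 w, P w & nrm (v - w) < e.

Definition totally_bounded {V : zmodType} (nrm : V -> R) (S : set V) : Prop :=
  forall e : R, 0 < e -> exists s : seq V,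
      forall x, S x -> exists2 y, y \in s & nrm (x - y) < e.

Definition unital_cstar_algebra (A : algType C) (star : A -> A) (nrm : A -> R)
  : Prop :=
  [/\ [/\ (forall a, star (star a) = a),
          (forall a b, star (a + b) = star a + star b),
          (forall (c : C) a, star (c *: a) = c^* *: star a) &
          (forall a b, star (a * b) = star b * star a)],
      [/\ (forall a, 0 <= nrm a), (forall a, nrm a = 0 -> a = 0),
          (forall a b, nrm (a + b) <= nrm a + nrm b) &
          (forall (c : C) a, nrm (c *: a) = cabs c * nrm a)],
      (forall a b, nrm (a * b) <= nrm a * nrm b),
      (forall a, nrm (star a * a) = nrm a ^+ 2) &
      is_complete nrm].

Definition positive (A : algType C) (star : A -> A) (a : A) : Prop :=
  exists b, a = star b * b.

Definition dense_unital_star_subalgebra (A : algType C) (star : A -> A)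
  (nrm : A -> R) (P : set A) : Prop :=
  [/\ P 1, (forall a b, P a -> P b -> P (a + b)) /\
      (forall (c : C) a, P a -> P (c *: a)),
      (forall a b, P a -> P b -> P (a * b)),
      (forall a, P a -> P (star a)) & is_dense nrm P].

Definition hilbert_module_norm (A : algType C) (nrm : A -> R) (X : lmodType C)
  (ip : X -> X -> A) (x : X) : R := Num.sqrt (nrm (ip x x)).

Definition right_hilbert_module (A : algType C) (star : A -> A) (nrm : A -> R)
  (X : lmodType C) (act : X -> A -> X) (ip : X -> X -> A) : Prop :=
  [/\ [/\ (forall x y a, act (x + y) a = act x a + act y a),
          (forall x a b, act x (a + b) = act x a + act x b),
          (forall (c : C) x a, act (c *: x) a = c *: act x a /\
                               act x (c *: a) = c *: act x a),
          (forall x a b, act x (a * b) = act (act x a) b) &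
          (forall x, act x 1 = x)],
      (forall x y z, ip x (y + z) = ip x y + ip x z) /\
      (forall (c : C) x y, ip x (c *: y) = c *: ip x y),
      (forall x y a, ip x (act y a) = ip x y * a),
      (forall x y, ip y x = star (ip x y)) &
      [/\ (forall x, positive star (ip x x)),
          (forall x, ip x x = 0 -> x = 0) &
          is_complete (hilbert_module_norm nrm ip)]].

Definition dense_compatible_subspace (A : algType C) (nrm : A -> R)
  (X : lmodType C) (act : X -> A -> X) (ip : X -> X -> A)
  (PA : set A) (PX : set X) : Prop :=
  [/\ PX 0, (forall x y, PX x -> PX y -> PX (x + y)) /\
      (forall (c : C) x, PX x -> PX (c *: x)),
      is_dense (hilbert_module_norm nrm ip) PX,
      (forall x a, PX x -> PA a -> PX (act x a)) &
      (forall x y, PX x -> PX y -> PA (ip x y))].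

(* L : a seminorm on the subspace P (values outside P are irrelevant) *)
Definition seminorm_on {V : lmodType C} (P : set V) (L : V -> R) : Prop :=
  [/\ (forall x, P x -> 0 <= L x),
      (forall x y, P x -> P y -> L (x + y) <= L x + L y) &
      (forall (c : C) x, P x -> L (c *: x) = cabs c * L x)].

Definition slip_norm (A : algType C) (star : A -> A) (P : set A) (L : A -> R)
  : Prop :=
  [/\ seminorm_on P L, L 1 = 0 & (forall a, P a -> L (star a) = L a)].

(* a state on the operator system P (a functional is identified with its
   restriction to P; values outside P are irrelevant) *)
Definition is_state (A : algType C) (star : A -> A) (P : set A) (mu : A -> C)
  : Prop :=
  [/\ (forall a b, P a -> P b -> mu (a + b) = mu a + mu b),
      (forall (c : C) a, P a -> mu (c *: a) = c * mu a),
      mu 1 = 1 &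
      (forall a, P a -> positive star a -> 0 <= mu a)].

Definition mk_dist (A : algType C) (P : set A) (L : A -> R) (mu nu : A -> C)
  : \bar R :=
  ereal_sup [set ((cabs (mu a - nu a))%:E) | a in [set a | P a /\ L a <= 1]].

Definition weakstar_nbhd (A : algType C) (star : A -> A) (P : set A)
  (mu : A -> C) (U : set (A -> C)) : Prop :=
  exists (s : seq A) (e : R), [/\ (forall a, a \in s -> P a), 0 < e &
    forall nu, is_state star P nu ->
      (forall a, a \in s -> cabs (nu a - mu a) < e) -> U nu].

Definition dist_nbhd (A : algType C) (star : A -> A) (P : set A) (L : A -> R)
  (mu : A -> C) (U : set (A -> C)) : Prop :=
  exists2 e : R, 0 < e & forall nu, is_state star P nu ->
      (mk_dist P L mu nu < e%:E)%E -> U nu.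

(* (P, L) is a compact quantum metric space: d_L induces the weak*
   topology on the state space, i.e. the two neighbourhood systems agree
   at every state *)
Definition compact_quantum_metric_space (A : algType C) (star : A -> A)
  (P : set A) (L : A -> R) : Prop :=
  forall mu, is_state star P mu -> forall U : set (A -> C),
    weakstar_nbhd star P mu U <-> dist_nbhd star P L mu U.

Definition finite_frame (A : algType C) (X : lmodType C) (act : X -> A -> X)
  (ip : X -> X -> A) (PX : set X) (n : nat) (zeta : 'I_n -> X) : Prop :=
  (forall j, PX (zeta j)) /\
  (forall x, PX x -> \sum_(j < n) act (zeta j) (ip (zeta j) x) = x).

End CStar.

(* Main.v *)
(* The frame identity gives <x - y, x - y> = sum_j d_j^* d_j with d_j = <zeta_j, x - y>, so it
   suffices that finitely many points approximate all the elements <zeta_j, x> of A0 in norm.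
   By (1) and (2) these elements have bounded norm and bounded L0, hence they are uniformly
   Lipschitz functions on the state space for d_{L0}. The state space is weak* compact, hence
   covered by finitely many small d_{L0}-balls, and approximating the values at the centres
   (bounded complex numbers) approximates all states, hence the norm.

   The C*-algebra input is that states detect the norm up to a factor 2. Positivity is measured
   by balls: a selfadjoint a is "pos" when |t - a| <= t for some t >= 0. Norm-one functionals
   with value 1 at 1, given by Hahn-Banach, are nonnegative on pos elements, and b^* b is pos
   (Kaplansky). *)
Require Import Defs.
From HB Require Import structures.
From mathcomp Require Import all_boot all_order all_algebra.
From mathcomp Require Import complex ring lra.
From mathcomp Require Import boolp classical_sets filter reals constructive_ereal ereal.
Import Order.TTheory GRing.Theory Num.Theory.
Local Open Scope ring_scope.
Local Open Scope classical_set_scope.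

Set Implicit Arguments.
Unset Strict Implicit.
Unset Printing Implicit Defensive.

(** * Estimates for powers of a real number *)

Section RealBounds.
Variable R : realType.

Lemma ler_addeps (x y c : R) :
  0 <= c -> (forall e, 0 < e -> e <= 1 -> x <= y + c * e) -> x <= y.
Proof.
move=> c0 H; rewrite leNgt; apply/negP => yx.
pose e := Num.min 1 ((x - y) / (c + 1) / 2).
have d0 : 0 < (x - y) / (c + 1) by apply: divr_gt0; lra.
have e0 : 0 < e by rewrite /e lt_min ltr01/=; lra.
have e1 : e <= 1 by rewrite /e ge_min lexx.
have e2 : e <= (x - y) / (c + 1) / 2 by rewrite /e ge_min lexx orbT.
have := H e e0 e1.
have : (c + 1) * e <= (x - y) / 2.
  rewrite mulrC -ler_pdivlMr; last by lra.
  by apply: le_trans e2 _; rewrite mulrAC.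
nra.
Qed.

(** 1 - s^n is 1 - s times a sum of n powers of s, each at least s^n. This makes s^n decay like 1/n;
    [pos_expr_lin] is the analogue in the algebra. *)
Lemma expr_lin_le (s : R) n : 0 <= s < 1 -> n%:R * ((1 - s) * s ^+ n) <= 1 - s ^+ n.
Proof.
move=> /andP[s0 s1].
elim: n => [|n IH]; first by rewrite mul0r expr0 subrr.
have : 0 <= (1 - s) * (1 - s ^+ n.+1).
  by rewrite mulr_ge0// subr_ge0 ?exprn_ile1// ltW.
by rewrite -natr1 exprS; have := ler_wpM2l s0 IH; lra.
Qed.

Lemma expr_small (s e : R) : 0 <= s < 1 -> 0 < e -> exists n, s ^+ n < e.
Proof.
move=> s01 e0; have H n := expr_lin_le n s01; move: s01 => /andP[s0 s1].
pose c := ((1 - s) * e)^-1; have se : 0 < (1 - s) * e by rewrite mulr_gt0 ?subr_gt0.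
have c0 : 0 < c by rewrite invr_gt0.
exists (Num.bound c); have := archi_boundP (ltW c0); have := H (Num.bound c).
set n := (Num.bound c); rewrite /c => Hn cn.
rewrite ltNge; apply/negP => sn.
have := exprn_ge0 n s0.
have : 1 < n%:R * ((1 - s) * e) by rewrite -ltr_pdivrMr// div1r.
have /ler_wpM2l/(_ _ _ sn) : 0 <= n%:R * (1 - s) by rewrite mulr_ge0// subr_ge0 ltW.
lra.
Qed.

(** If s < r, put q = s / r < 1: the hypothesis becomes s <= q^N (s + N m) with N = 2^k, while N q^N
    tends to 0. *)
Lemma expr_lin_contra (r s m : R) : 0 < s -> 0 <= m ->
  (forall k, s * r ^+ (2 ^ k) <= s ^+ (2 ^ k) * (s + (2 ^ k)%:R * m)) -> r <= s.
Proof.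
move=> s0 m0 H; rewrite leNgt; apply/negP => rs.
have r0 : 0 < r by apply: lt_trans rs.
pose q := s / r.
have q0 : 0 < q by rewrite divr_gt0.
have q1 : q < 1 by rewrite ltr_pdivrMr// mul1r.
have q01 : 0 <= q < 1 by rewrite q1 ltW.
pose c := s * (1 - q) + 2 * m.
have c0 : 0 < c by rewrite ltr_wpDr ?mulr_ge0// mulr_gt0 ?subr_gt0.
have [|k Hk] := @expr_small q (s * (1 - q) / c) q01.
  by rewrite divr_gt0// mulr_gt0 ?subr_gt0.
have {}Hk : q ^+ (2 ^ k) * c < s * (1 - q).
  rewrite -ltr_pdivlMr//; apply: le_lt_trans Hk.
  by apply: ler_wiXn2l; [exact: ltW|exact: ltW|exact/ltnW/ltn_expl].
(* In the exponent 2^(k+1) one factor q^(2^k) is small by [Hk], and the other absorbs 2^k through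
   [expr_lin_le]. *)
have := H k.+1.
have -> : s ^+ (2 ^ k.+1) = q ^+ (2 ^ k.+1) * r ^+ (2 ^ k.+1).
  by rewrite -exprMn divfK// gt_eqF.
rewrite mulrAC ler_pM2r ?exprn_gt0//.
move=> {}H; have := expr_lin_le (2 ^ k) q01.
move: H Hk; rewrite expnSr exprM natrM.
have : 0 <= q ^+ (2 ^ k) <= 1 by rewrite exprn_ge0 ?exprn_ile1 ?ltW.
rewrite /c expr2; move: (q ^+ _) ((2 ^ k)%:R : R) => x N /andP[x0 x1] H1 H2 H3.
have d0 : 0 <= 1 - q by lra.
have := ler_wpM2l d0 H1.
have /ler_wpM2l/(_ _ _ H3) : 0 <= 2 * m * x by rewrite !mulr_ge0.
have : 0 <= (1 - q) * s * x * (1 - x) by rewrite !mulr_ge0 ?subr_ge0// ltW.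
have : 0 <= m * x * x by rewrite !mulr_ge0.
lra.
Qed.

End RealBounds.

(** * Complex modulus, real and imaginary parts *)

Section ComplexModulus.
Variable R : realType.
Implicit Type z : R[i].
Local Notation rc := (real_complex R).
Local Notation I := (Complex (0 : R) 1).

Lemma cabs_real (r : R) : cabs (rc r) = `|r|.
Proof. by rewrite /cabs /= expr0n /= addr0 sqrtr_sqr. Qed.

Lemma conj_real (r : R) : (rc r)^* = rc r.
Proof. by rewrite /Num.conj /= /conjc /= oppr0. Qed.

Lemma conj_I : I^* = - I.
Proof. by apply/eqP; rewrite /Num.conj /= /conjc eq_complex /= oppr0 !eqxx. Qed.

Lemma cabs_I : cabs I = 1.
Proof. by rewrite /cabs /= expr0n /= add0r expr1n sqrtr1. Qed.

Lemma cabs_ge0 z : 0 <= cabs z.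
Proof. by case: z => u v; exact: sqrtr_ge0. Qed.

Lemma Re_le_cabs z : `|complex.Re z| <= cabs z.
Proof. by case: z => u v; rewrite /cabs /= -sqrtr_sqr ler_wsqrtr// lerDl sqr_ge0. Qed.

Lemma Im_le_cabs z : `|complex.Im z| <= cabs z.
Proof. by case: z => u v; rewrite /cabs /= -sqrtr_sqr ler_wsqrtr// lerDr sqr_ge0. Qed.

Lemma cabsD z z' : cabs (z + z') <= cabs z + cabs z'.
Proof. exact: le_normcD. Qed.

Lemma cabsN z : cabs (- z) = cabs z.
Proof. exact: normcN. Qed.

Lemma cabsM z z' : cabs (z * z') = cabs z * cabs z'.
Proof. exact: Normc.normcM. Qed.

Lemma cabs_le_ReIm z : cabs z <= `|complex.Re z| + `|complex.Im z|.
Proof.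
case: z => u v /=; rewrite /cabs /= -[leRHS]ger0_norm ?addr_ge0// -sqrtr_sqr.
rewrite ler_wsqrtr// -(real_normK (num_real u)) -(real_normK (num_real v)).
have : 0 <= `|u| * `|v| by rewrite mulr_ge0.
by lra.
Qed.

Lemma cabs_small z c : 0 <= c ->
  (forall e, 0 < e -> cabs z <= c * e) -> z = 0.
Proof.
move=> c0 H; apply: Normc.eq0_normc; apply: le_anti; rewrite -/(cabs z) cabs_ge0 andbT.
by apply: (ler_addeps c0) => e e0 _; rewrite add0r; exact: H.
Qed.

End ComplexModulus.

(** * Ultrafilter limits and finite nets for real functions *)

(** The limit is the supremum of the r such that r <= g holds on a member of F; the ultrafilter
    property supplies the bound from above. *)
Lemma ultra_bounded_lim (R : realType) T (F : set_system T) (g : T -> R) M :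
  UltraFilter F -> F [set x | `|g x| <= M] ->
  exists l, forall e, 0 < e -> F [set x | `|g x - l| < e].
Proof.
move=> FU FM; pose S := [set r | F [set x | r <= g x]].
have S0 : S !=set0.
  by exists (- M); apply: filterS FM => x /=; rewrite ler_norml => /andP[].
have SM : ubound S M.
  move=> r Sr; have [x [/= rg]] := filter_ex (filterI Sr FM).
  by rewrite ler_norml => /andP[_]; exact: le_trans.
have Ss : has_sup S by split=> //; exists M.
exists (sup S) => e e0.
have [r Sr rs] := sup_adherent e0 Ss.
have [H|H] := in_ultra_setVsetC [set x | sup S + e <= g x] FU.
  by have := sup_upper_bound Ss H; lra.
apply: filterS (filterI Sr H) => x [/= rg /negP]; rewrite -ltNge => ge.
by rewrite ltr_norml; lra.
Qed.

(** Induction on the functions: S is cut into finitely many slabs on which the first function varies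
    by less than e, and each slab gets a net for the remaining ones. *)
Lemma finite_net (R : realType) (T : eqType) (gs : seq (T -> R)) (S : set T) (e : R) :
  0 < e -> (forall g, g \in gs -> exists M, forall x, S x -> `|g x| <= M) ->
  exists s : seq T, forall x, S x ->
    exists y, [/\ y \in s, S y & forall g, g \in gs -> `|g x - g y| < e].
Proof.
move=> e0; elim: gs S => [|g gs IH] S bd.
  have [[x0 Sx0]|S0] := pselect (S !=set0); last first.
    by exists [::] => x Sx; case: S0; exists x.
  by exists [:: x0] => x _; exists x0; rewrite mem_seq1 eqxx.
have [M gM] := bd g (mem_head _ _).
(* N counts the slabs of height e above -M; the topmost one is handled by [IH], the others by
   induction. *)
have slab N (S' : set T) : S' `<=` S ->
    (forall x, S' x -> g x < - M + N%:R * e) -> exists s : seq T, forall x, S' x ->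
    exists y, [/\ y \in s, S' y & forall g', g' \in g :: gs -> `|g' x - g' y| < e].
  elim: N S' => [|N IHN] S' S'S up.
    exists [::] => x S'x; have := up x S'x; rewrite mul0r addr0.
    by have := gM x (S'S x S'x); rewrite ler_norml => /andP[]; lra.
  have [||s1 H1] := IHN (S' `&` [set x | g x < - M + N%:R * e]).
  - by move=> x [/S'S].
  - by move=> x [].
  have [|s2 H2] := IH (S' `&` [set x | - M + N%:R * e <= g x]).
    move=> g' gg'; have [|M' HM'] := bd g'; first by rewrite inE gg' orbT.
    by exists M' => x [/S'S/HM'].
  exists (s1 ++ s2) => x S'x.
  have [gx|gx] := ltP (g x) (- M + N%:R * e).
    have [//|y [ys [Sy _] yg]] := H1 x.
    by exists y; split=> //; rewrite mem_cat ys.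
  have [//|y [ys [Sy /= gy] yg]] := H2 x.
  exists y; split=> // [|g']; first by rewrite mem_cat ys orbT.
  rewrite inE => /orP[/eqP ->|]; last exact: yg.
  have := up x S'x; have := up y Sy; rewrite -natr1 ltr_norml; lra.
have [M0|M0] := ltP M 0.
  exists [::] => x /gM; have := normr_ge0 (g x); lra.
apply: (slab (Num.bound (2 * M / e)).+1 S) => // x /gM.
rewrite ler_norml => /andP[_ gx].
have Me : 0 <= 2 * M / e by apply: divr_ge0; [exact: mulr_ge0|exact: ltW].
by have := archi_boundP Me; rewrite ltr_pdivrMr// -natr1; lra.
Qed.

(** * The Hahn-Banach theorem for real-linear functionals *)

Section HahnBanach.
Variables (R : realType) (V : lmodType R[i]).
Local Notation rc := (real_complex R).

Definition sublinear (p : V -> R) := (forall x y, p (x + y) <= p x + p y) /\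
  (forall r x, 0 < r -> p (rc r *: x) <= r * p x).

Lemma sublinear0 p : sublinear p -> p 0 = 0.
Proof.
move=> [_ pZ]; have := pZ 2 0 (ltr0n _ _); have := pZ 2^-1 0.
rewrite !scaler0 invr_gt0 ltr0n => /(_ isT); lra.
Qed.

Lemma sublinear_opp_le p x : sublinear p -> - p (- x) <= p x.
Proof.
move=> ps; have [pD _] := ps.
have := pD x (- x); rewrite subrr (sublinear0 ps); lra.
Qed.

(** The sublinear minorant of p whose value at -y is at most - p y, so that every linear functional
    below it agrees with p at y. *)
Definition descent (p : V -> R) y x :=
  inf [set p (x + rc s *: y) - s * p y | s in [set s | 0 <= s]].

Lemma sublinear_ge0Z p s y : sublinear p -> 0 <= s -> p (rc s *: y) = s * p y.
Proof.
move=> ps; have [_ pZ] := ps; rewrite le_eqVlt => /orP[/eqP <-|s0].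
  by rewrite scale0r mul0r sublinear0.
apply: le_anti; rewrite pZ//=.
have := pZ s^-1 (rc s *: y); rewrite invr_gt0 s0 scalerA -rmorphM => /(_ isT).
by rewrite mulVf ?gt_eqF// scale1r -ler_pdivrMl ?invr_gt0// invrK.
Qed.

Lemma descent_le p y x s : sublinear p -> 0 <= s ->
  descent p y x <= p (x + rc s *: y) - s * p y.
Proof.
move=> ps s0; apply: ge_inf; last by exists s.
exists (- p (- x)) => _ [r r0 <-]; have [pD _] := ps.
have := pD (x + rc r *: y) (- x).
by rewrite addrC addKr sublinear_ge0Z//; lra.
Qed.

Lemma le_descent p y x c : sublinear p ->
  (forall s, 0 <= s -> c <= p (x + rc s *: y) - s * p y) -> c <= descent p y x.
Proof.
move=> ps H; apply: lb_le_inf; first by eexists; exists 0; [exact: lexx|].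
by move=> _ [s s0 <-]; apply: H.
Qed.

Lemma descent_sublinear p y : sublinear p -> sublinear (descent p y).
Proof.
move=> ps; have [pD pZ] := ps; split.
  move=> x z; rewrite -lerBlDr; apply: le_descent => // s s0.
  rewrite lerBlDr -lerBlDl; apply: le_descent => // t t0.
  have := descent_le y (x + z) ps (addr_ge0 s0 t0).
  rewrite rmorphD scalerDl addrACA.
  have := pD (x + rc s *: y) (z + rc t *: y); lra.
move=> r x r0; rewrite -ler_pdivrMl//; apply: le_descent => // s s0.
rewrite ler_pdivrMl//.
have := descent_le y (rc r *: x) ps (mulr_ge0 (ltW r0) s0).
rewrite rmorphM -scalerA -scalerDr; have := pZ r (x + rc s *: y) r0; lra.
Qed.

(* A minimal sublinear functional is linear, since descending along y cannot decrease it. *)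
Theorem hahn_banach (p : V -> R) x0 : sublinear p ->
  exists f : V -> R, [/\ (forall x y, f (x + y) = f x + f y),
    (forall r x, f (rc r *: x) = r * f x), (forall x, f x <= p x) & f x0 = p x0].
Proof.
(* Searching only below [descent p x0] forces the value p x0 at x0. *)
move=> ps; pose p0 := descent p x0.
have p0s : sublinear p0 by exact: descent_sublinear.
pose T := {q : V -> R | sublinear q /\ forall x, q x <= p0 x}.
(* The order is reversed, so that Zorn's lemma yields a minimal functional; chains are bounded by
   their pointwise infimum. *)
pose le (q r : T) := `[< forall x, sval r x <= sval q x >].
have [|||A Atot|[q [qs qp]] qmin] := @Zorn T le.
- by move=> t; apply/asboolP.
- move=> r s t /asboolP rs /asboolP st; apply/asboolP => x.
  exact: le_trans (st x) (rs x).
- move=> s t /asboolP st /asboolP ts; apply: eq_sig_hprop => [?|]; first exact: Prop_irrelevance.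
  apply/funext => x.
  by apply: le_anti; rewrite ts st.
- have [[r0 Ar0]|A0] := pselect (A !=set0); last first.
    exists (exist _ p0 (conj p0s (fun x => lexx _))) => s As.
    by case: A0; exists s.
  pose q x := inf [set sval r x | r in A].
  have q_le r x : A r -> q x <= sval r x.
    move=> Ar; apply: ge_inf; last by exists r.
    exists (- p0 (- x)) => _ [[s [ss sp]] As <-] /=.
    have := sublinear_opp_le x ss; have := sp (- x); lra.
  have le_q x c : (forall r, A r -> c <= sval r x) -> c <= q x.
    move=> H; apply: lb_le_inf; first by exists (sval r0 x); exists r0.
    by move=> _ [r Ar <-]; apply: H.
  have qs : sublinear q.
    split=> [x y|r x r0'].
      rewrite -lerBlDr; apply: (@le_q _ _) => r Ar; rewrite lerBlDr -lerBlDl.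
      apply: (@le_q _ _) => s As; rewrite lerBlDl.
      (* The smaller of the two chain members lies below both, so its own subadditivity suffices. *)
      have [/asboolP rs|/asboolP sr] := Atot _ _ Ar As.
        case: (svalP s) => -[/(_ x y) sD _] _.
        by have := q_le s (x + y) As; have := rs x; lra.
      case: (svalP r) => -[/(_ x y) rD _] _.
      by have := q_le r (x + y) Ar; have := sr y; lra.
    rewrite -ler_pdivrMl//; apply: (@le_q _ _) => s As; rewrite ler_pdivrMl//.
    case: (svalP s) => -[_ /(_ r x r0') sZ] _.
    exact: le_trans (q_le _ _ As) sZ.
  have qp x : q x <= p0 x.
    by apply: le_trans (q_le _ _ Ar0) _; case: (svalP r0).
  by exists (exist _ q (conj qs qp)) => s As; apply/asboolP => x; exact: q_le.
have qd y x : q x + q y <= q (x + y).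
  have ds := descent_sublinear y qs.
  have dq z : descent q y z <= q z.
    by have := descent_le y z qs (lexx 0); rewrite scale0r mul0r subr0 addr0.
  have dp z : descent q y z <= p0 z by apply: le_trans (dq z) (qp z).
  have le_qd : le (exist _ q (conj qs qp)) (exist _ _ (conj ds dp)).
    by apply/asboolP => z; exact: dq.
  have /(congr1 sval)/= E := qmin _ le_qd.
  have := descent_le y x qs ler01.
  by rewrite E scale1r mul1r; lra.
have [qD qZ] := qs.
have q0 := sublinear0 qs.
have qadd x y : q (x + y) = q x + q y by apply: le_anti; rewrite qD qd.
have qN x : q (- x) = - q x.
  by have := qadd x (- x); rewrite subrr q0; lra.
have pp x : p0 x <= p x.
  by have := descent_le x0 x ps (lexx 0); rewrite scale0r mul0r subr0 addr0.
exists q; split=> // [r x|x|]; last 2 first.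
- exact: le_trans (qp x) (pp x).
- apply: le_anti; rewrite (le_trans (qp x0) (pp x0))//=.
  have := descent_le x0 (- x0) ps ler01; rewrite scale1r addNr mul1r (sublinear0 ps).
  by have := qp (- x0); rewrite qN -/p0; lra.
have [r0|/ltW r0] := leP 0 r; first exact: sublinear_ge0Z.
have := sublinear_ge0Z x qs (_ : 0 <= - r); rewrite oppr_ge0 => /(_ r0).
by rewrite rmorphN scaleNr qN; lra.
Qed.
End HahnBanach.

(** * Norm, involution and scalars in a C^*-algebra; square roots *)

Section CStarAlgebra.
Variables (R : realType) (A : algType R[i]) (star : A -> A) (nrm : A -> R).
Hypothesis HA : unital_cstar_algebra star nrm.

Local Notation rc := (real_complex R).
Local Notation I := (Complex (0 : R) 1).
Local Notation K t := (rc t *: (1 : A)).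

Let starK a : star (star a) = a. Proof. by case: HA => [[]]. Qed.
Let starD a b : star (a + b) = star a + star b. Proof. by case: HA => [[]]. Qed.
Let starZ c a : star (c *: a) = c^* *: star a. Proof. by case: HA => [[]]. Qed.
Let starM a b : star (a * b) = star b * star a. Proof. by case: HA => [[]]. Qed.
Let nrm_ge0 a : 0 <= nrm a. Proof. by case: HA => [_ []]. Qed.
Let nrm_eq0 a : nrm a = 0 -> a = 0.
Proof. by case: HA => [_ [_ + _ _ _ _ _]]; apply. Qed.
Let nrmD a b : nrm (a + b) <= nrm a + nrm b. Proof. by case: HA => [_ []]. Qed.
Let nrmZ c a : nrm (c *: a) = cabs c * nrm a. Proof. by case: HA => [_ []]. Qed.
Let nrmM a b : nrm (a * b) <= nrm a * nrm b. Proof. by case: HA. Qed.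
Let nrm_star_mul a : nrm (star a * a) = nrm a ^+ 2. Proof. by case: HA. Qed.

Let starZr r a : star (rc r *: a) = rc r *: star a.
Proof. by rewrite starZ conj_real. Qed.

Let starN a : star (- a) = - star a.
Proof. by rewrite -scaleN1r -[-1]/(- (rc 1)) -rmorphN starZr rmorphN scaleN1r. Qed.

Let starB a b : star (a - b) = star a - star b.
Proof. by rewrite starD starN. Qed.

Let star1 : star 1 = 1.
Proof. by rewrite -[LHS]mulr1 -{2}[1]starK -starM mulr1 starK. Qed.

Let starI a : star (I *: a) = - (I *: star a).
Proof. by rewrite starZ conj_I scaleNr. Qed.

Let nrmZr r a : nrm (rc r *: a) = `|r| * nrm a.
Proof. by rewrite nrmZ cabs_real. Qed.

Let nrm0 : nrm 0 = 0.
Proof. by rewrite -(scale0r (1 : A)) -[0]/(rc 0) nrmZr normr0 mul0r. Qed.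

Let nrmN a : nrm (- a) = nrm a.
Proof. by rewrite -scaleN1r -[-1]/(- (rc 1)) -rmorphN nrmZr normrN normr1 mul1r. Qed.

Let nrmB a b : nrm (a - b) <= nrm a + nrm b.
Proof. by rewrite -(nrmN b); exact: nrmD. Qed.

Let nrm_star a : nrm (star a) = nrm a.
Proof.
have le b : nrm b <= nrm (star b).
  have [->//|b0] := eqVneq (nrm b) 0.
  have: nrm b * nrm b <= nrm (star b) * nrm b.
    by rewrite -expr2 -nrm_star_mul; exact: nrmM.
  by rewrite ler_pM2r// lt_neqAle eq_sym b0 nrm_ge0.
by apply/le_anti; rewrite le andbT -{2}[a]starK le.
Qed.

Let nrm_saM a : star a = a -> nrm (a * a) = nrm a ^+ 2.
Proof. by move=> sa; rewrite -nrm_star_mul sa. Qed.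

Let nrm1 : nrm 1 = 1.
Proof.
have := nrm_saM star1; rewrite mulr1 => /eqP.
rewrite expr2 -subr_eq0 -{1}[nrm 1]mulr1 -mulrBr mulf_eq0 => /orP[/eqP n1|].
  by have := nrm_eq0 n1 => /eqP; rewrite oner_eq0.
by rewrite subr_eq0 => /eqP.
Qed.

Let nrmK t : nrm (K t) = `|t|.
Proof. by rewrite nrmZr nrm1 mulr1. Qed.

Let starKt t : star (K t) = K t.
Proof. by rewrite starZr star1. Qed.

Let KD s t : K (s + t) = K s + K t.
Proof. by rewrite rmorphD scalerDl. Qed.
Let KB s t : K (s - t) = K s - K t.
Proof. by rewrite rmorphB scalerBl. Qed.
Let KM s t : K (s * t) = K s * K t.
Proof. by rewrite rmorphM -scalerAl mul1r scalerA. Qed.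
Let mulKl t a : K t * a = rc t *: a. Proof. by rewrite -scalerAl mul1r. Qed.
Let mulKr t a : a * K t = rc t *: a. Proof. by rewrite -scalerAr mulr1. Qed.
Let K0 : K 0 = 0. Proof. exact: scale0r. Qed.
Let K1 : K 1 = 1. Proof. exact: scale1r. Qed.

(* Fixed point of the contraction y |-> (x + y^2)/2, so that (1 - y)^2 = 1 - x. *)
Lemma sqrt_one_sub x : star x = x -> nrm x < 1 ->
  exists h, [/\ star h = h, h * h = 1 - x &
    forall z, z * x = x * z -> z * h = h * z].
Proof.
move=> sx x1.
pose s := nrm x; have s0 : 0 <= s by exact: nrm_ge0.
pose g (y : A) : A := rc 2^-1 *: (x + y * y).
pose u n := iter n g 0.
have us n : star (u n) = u n.
  by elim: n => [|n IH] /=; rewrite ?starZr ?starD ?starM ?IH ?sx// -K0 starKt.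
have un n : nrm (u n) <= s.
  elim: n => [|n IH] /=; first by rewrite nrm0.
  rewrite nrmZr ger0_norm ?invr_ge0//.
  have := nrmD x (u n * u n); have := nrmM (u n) (u n).
  rewrite /s in IH *; have := nrm_ge0 (u n); move: x1 s0; rewrite /s.
  nra.
have uc n z : z * x = x * z -> z * u n = u n * z.
  move=> zx; elim: n => [|n IH] /=; first by rewrite mulr0 mul0r.
  by rewrite -scalerAl -scalerAr mulrDl mulrDr zx mulrA IH -mulrA IH mulrA.
(* Splitting y^2 - z^2 as y (y - z) + (y - z) z needs no commutation and gives the Lipschitz
   constant s on the ball of radius s. *)
have gg y z : nrm y <= s -> nrm z <= s -> nrm (g y - g z) <= s * nrm (y - z).
  move=> ys zs; rewrite /g -scalerBr opprD addrACA subrr add0r.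
  rewrite nrmZr ger0_norm ?invr_ge0//.
  have -> : y * y - z * z = y * (y - z) + (y - z) * z.
    by rewrite mulrBr mulrBl addrA subrK.
  have := nrmD (y * (y - z)) ((y - z) * z).
  have := nrmM y (y - z); have := nrmM (y - z) z.
  have := nrm_ge0 (y - z); nra.
have u1 n : nrm (u n.+1 - u n) <= s ^+ n.
  elim: n => [|n IH].
    by rewrite expr0 subr0; apply: (le_trans (un 1%N)); exact: ltW.
  rewrite exprS; have := gg _ _ (un n.+1) (un n).
  by move=> /le_trans; apply; apply: ler_wpM2l.
have ud n m : (1 - s) * nrm (u (n + m)%N - u n) <= s ^+ n.
  suff: (1 - s) * nrm (u (n + m)%N - u n) <= s ^+ n - s ^+ (n + m).
    by move=> /le_trans; apply; rewrite lerBlDr lerDl; exact: exprn_ge0.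
  elim: m => [|m IH]; first by rewrite addn0 !subrr nrm0 mulr0.
  have := nrmD (u (n + m).+1 - u (n + m)%N) (u (n + m)%N - u n).
  rewrite addrA subrK addnS => H; have := u1 (n + m)%N.
  have -> : s ^+ (n + m).+1 = s * s ^+ (n + m) by rewrite exprS.
  have : 0 < 1 - s by rewrite subr_gt0.
  nra.
have sN e : 0 < e -> exists N, s ^+ N < e.
  by move=> e0; apply: expr_small => //; rewrite s0 x1.
have cau e : 0 < e -> exists N, forall m n, (N <= m)%N -> (N <= n)%N ->
    nrm (u m - u n) < e.
  have s1 : 0 < 1 - s by rewrite subr_gt0.
  move=> e0; have /sN[N HN] : 0 < (1 - s) * e / 2 by rewrite divr_gt0// mulr_gt0.
  exists N => m n Nm Nn.
  have := ud N (m - N)%N; have := ud N (n - N)%N; rewrite !subnKC//.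
  have := nrmB (u m - u N) (u n - u N).
  rewrite opprB addrA subrK; nra.
have [y yl] : exists a, forall e, 0 < e -> exists N, forall n, (N <= n)%N ->
    nrm (u n - a) < e by case: HA => _ _ _ _; apply.
have lim e : 0 < e -> exists n, nrm (u n - y) + nrm (u n.+1 - y) <= e.
  move=> e0; have [|n Hn] := yl (e / 2); first exact: divr_gt0.
  by exists n; have := Hn n (leqnn _); have := Hn n.+1 (leqnSn _); lra.
(* Two consecutive errors are allowed because the fixed point equation compares [u n] with
   [u n.+1]. *)
have small a c : 0 <= c ->
    (forall n, nrm a <= c * (nrm (u n - y) + nrm (u n.+1 - y))) -> a = 0.
  move=> c0 H; apply: nrm_eq0; apply: le_anti; rewrite nrm_ge0 andbT.
  apply: (ler_addeps c0) => e e0 _; rewrite add0r.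
  by have [n Hn] := lim _ e0; apply: le_trans (H n) _; apply: ler_wpM2l.
have ys : nrm y <= s.
  apply: (@ler_addeps _ _ _ 1) => // e e0 _; have [n Hn] := lim _ e0.
  have := nrmB (u n) (u n - y); rewrite opprB addrC subrK => H.
  by have := un n; have := nrm_ge0 (u n.+1 - y); lra.
have gy : g y = y.
  apply/eqP; rewrite -subr_eq0; apply/eqP/(small _ 1) => // n.
  have := nrmD (g y - g (u n)) (g (u n) - y); rewrite addrA subrK.
  have := gg _ _ ys (un n); rewrite -nrmN opprB -(nrmN (y - _)) opprB.
  rewrite -[g (u n)]/(u n.+1); have := nrm_ge0 (u n - y).
  rewrite mul1r; move: x1; rewrite -/s; nra.
have sy : star y = y.
  apply/eqP; rewrite -subr_eq0; apply/eqP/(small _ 2) => // n.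
  have := nrmB (u n - y) (star (u n - y)); rewrite nrm_star starB us.
  rewrite opprB addrC addrA subrK; have := nrm_ge0 (u n.+1 - y); lra.
exists (1 - y); split; first by rewrite starB star1 sy.
  rewrite mulrBl mul1r mulrBr mulr1.
  move: gy => /(congr1 (fun z => rc 2 *: z)).
  rewrite scalerA -rmorphM divff ?pnatr_eq0// scale1r.
  rewrite -[2]/(1 + 1 : R) rmorphD scalerDl scale1r => /(canRL (addrK _)) ->.
  by rewrite !opprB opprD -!addrA [- y + _]addrCA.
move=> z zx; rewrite mulrBr mulrBl mulr1 mul1r; congr (_ - _).
apply/eqP; rewrite -subr_eq0; apply/eqP/(small _ (2 * nrm z)) => [|n].
  by rewrite mulr_ge0.
have E : (u n - y) * z - z * (u n - y) = z * y - y * z.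
  by rewrite mulrBr mulrBl (uc n z zx) opprB [LHS]addrC addrA subrK.
have := nrmB ((u n - y) * z) (z * (u n - y)); rewrite E.
have := nrmM z (u n - y); have := nrmM (u n - y) z.
have := mulr_ge0 (nrm_ge0 z) (nrm_ge0 (u n.+1 - y)).
lra.
Qed.

(** * Positivity measured by norm balls *)

(** For selfadjoint a the second clause says that the spectrum lies in [0, 2 t]; sums then need only
    the triangle inequality. *)
Definition pos (a : A) := star a = a /\ exists2 t, 0 <= t & nrm (K t - a) <= t.

Lemma posD a b : pos a -> pos b -> pos (a + b).
Proof.
move=> [sa [s s0 Ha]] [sb [t t0 Hb]]; split; first by rewrite starD sa sb.
exists (s + t); first exact: addr_ge0.
by rewrite KD opprD addrACA; apply: le_trans (nrmD _ _) _; exact: lerD.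
Qed.

Lemma posZ r a : 0 <= r -> pos a -> pos (rc r *: a).
Proof.
move=> r0 [sa [s s0 Ha]]; split; first by rewrite starZr sa.
exists (r * s); first exact: mulr_ge0.
rewrite rmorphM -scalerA -scalerBr nrmZr ger0_norm//; exact: ler_wpM2l.
Qed.

Lemma posK t : 0 <= t -> pos (K t).
Proof. by move=> t0; split=> //; exists t => //; rewrite subrr nrm0. Qed.

Lemma pos_ball t a : 0 <= t -> star a = a -> nrm a <= t -> pos (K t - a).
Proof.
move=> t0 sa at_; split; first by rewrite starB sa starKt.
by exists t => //; rewrite opprB addrC subrK.
Qed.

(** a + e = (t + e) (1 - x) with x = (t - a) / (t + e), and the shift by e makes the norm of x less
    than 1, as [sqrt_one_sub] requires. *)
Lemma pos_sqrt a e : pos a -> 0 < e ->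
  exists h, [/\ star h = h, h * h = a + K e &
    forall z, z * a = a * z -> z * h = h * z].
Proof.
move=> [sa [t t0 Ha]] e0.
have te : 0 < t + e by rewrite ltr_wpDl.
pose x := rc (t + e)^-1 *: (K t - a).
have sx : star x = x by rewrite starZr starB sa starKt.
have [|g [sg gg gc]] := sqrt_one_sub sx.
  rewrite nrmZr ger0_norm ?invr_ge0 ?ltW// mulrC ltr_pdivrMr// mul1r; lra.
exists (rc (Num.sqrt (t + e)) *: g); split; first by rewrite starZr sg.
  rewrite -scalerAl -scalerAr scalerA -rmorphM -expr2 sqr_sqrtr ?ltW//.
  rewrite gg scalerBr /x scalerA -rmorphM divff ?gt_eqF// scale1r.
  by rewrite KD opprB addrC addrA subrK.
move=> z za; rewrite -scalerAl -scalerAr gc// /x -scalerAl -scalerAr.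
by rewrite mulrBr mulrBl za -scalerAl -scalerAr mulr1 mul1r.
Qed.

(* h is the real part of the normal element h + ik, whose squared norm is |h^2 + k^2|. *)
Lemma nrm_sq_le h k : star h = h -> star k = k -> h * k = k * h ->
  nrm (h * h) <= nrm (h * h + k * k).
Proof.
move=> sh sk hk.
pose z := h + I *: k.
have sz : star z = h - I *: k by rewrite starD starI sh sk.
have zz : star z * z = h * h + k * k.
  rewrite sz /z mulrDr !mulrBl -!scalerAl -!scalerAr hk scalerA.
  have -> : I * I = -1 by rewrite -expr2 sqr_i.
  by rewrite scaleN1r opprK addrA subrK.
rewrite -zz nrm_star_mul nrm_saM// lerXn2r ?nnegrE//.
have -> : h = rc 2^-1 *: (star z + z).
  rewrite sz /z addrACA addNr addr0 -mulr2n -scaler_nat scalerA.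
  by rewrite fmorphV rmorph_nat mulVf ?pnatr_eq0// scale1r.
rewrite nrmZr ger0_norm ?invr_ge0//; have := nrmD (star z) z; rewrite nrm_star; lra.
Qed.

(** t - h^2 is the square of a selfadjoint l commuting with h, so [nrm_sq_le] bounds its norm by
    that of l^2 + h^2 = t. *)
Lemma sq_ball h t : star h = h -> nrm (h * h) < t -> nrm (K t - h * h) <= t.
Proof.
move=> sh ht; have t0 : 0 < t by apply: le_lt_trans (nrm_ge0 _) ht.
pose x := rc t^-1 *: (h * h).
have [||k [sk kk kc]] := @sqrt_one_sub x; first by rewrite starZr starM sh.
  by rewrite nrmZr ger0_norm ?invr_ge0 ?ltW// mulrC ltr_pdivrMr// mul1r.
have hk : h * k = k * h by apply: kc; rewrite /x -scalerAl -scalerAr mulrA.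
pose l := rc (Num.sqrt t) *: k.
have sl : star l = l by rewrite starZr sk.
have ll : l * l = K t - h * h.
  rewrite -scalerAl -scalerAr scalerA -rmorphM -expr2 sqr_sqrtr ?ltW//.
  by rewrite kk scalerBr /x scalerA -rmorphM divff ?gt_eqF// scale1r.
have hl : l * h = h * l by rewrite -scalerAl -scalerAr hk.
by have := nrm_sq_le sl sh hl; rewrite ll subrK nrmK ger0_norm// ltW.
Qed.

Lemma pos_sq h : star h = h -> pos (h * h).
Proof.
move=> sh; split; first by rewrite starM sh.
exists (nrm (h * h) + 1); first by rewrite addr_ge0.
by apply: sq_ball => //; rewrite ltrDl.
Qed.

(** Frees the radius in [pos]: any t above the norm works, since a + e is a square to which
    [sq_ball] applies. *)
Lemma pos_nrm_ball a t : pos a -> nrm a < t -> nrm (K t - a) <= t.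
Proof.
move=> pa at_; have [sa _] := pa.
apply: (@ler_addeps _ _ _ 2) => // e e0 _.
have [h [sh hh _]] := pos_sqrt pa e0.
have := @sq_ball h (t + e) sh; rewrite hh.
have := nrmD a (K e); rewrite nrmK (gtr0_norm e0) => H1 H2.
have {}H2 : nrm (K (t + e) - (a + K e)) <= t + e by apply: H2; lra.
by move: H2; rewrite KD opprD addrACA subrr addr0; lra.
Qed.

(** All approximants b have norm below [nrm a + 2], so they satisfy the ball condition for this one
    radius, and a closed ball keeps its limits. *)
Lemma pos_closed a : star a = a ->
  (forall e, 0 < e -> e <= 1 -> exists2 b, pos b & nrm (a - b) <= e) -> pos a.
Proof.
move=> sa H; split=> //; exists (nrm a + 2); first by rewrite addr_ge0.
apply: (@ler_addeps _ _ _ 1) => // e e0 e1; have [b pb ab] := H e e0 e1.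
have bt : nrm b < nrm a + 2.
  by have := nrmB a (a - b); rewrite opprB addrC subrK; lra.
have := nrmB (K (nrm a + 2) - b) (a - b).
rewrite opprB addrA subrK; have := pos_nrm_ball pb bt; lra.
Qed.

(** Square roots h of a + e and k of b + e commute, so (a + e) (b + e) = (h k)^2 is the square of a
    selfadjoint element, and it approximates a b. *)
Lemma posM a b : pos a -> pos b -> a * b = b * a -> pos (a * b).
Proof.
move=> pa pb ab; have [sa _] := pa; have [sb _] := pb.
have s0 : 0 <= nrm a + nrm b + 1 by rewrite !addr_ge0.
apply: pos_closed => [|d d0 d1]; first by rewrite starM sa sb.
(* The error e (a + b) + e^2 has norm at most e (nrm a + nrm b + 1) = d, because e <= 1. *)
pose e := d / (nrm a + nrm b + 1).
have e0 : 0 < e by rewrite divr_gt0// ltr_wpDl// addr_ge0.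
have e1 : e <= 1.
  by rewrite ler_pdivrMr; have := nrm_ge0 a; have := nrm_ge0 b; lra.
have [h [sh hh hc]] := pos_sqrt pa e0.
have [k [sk kk kc]] := pos_sqrt pb e0.
have hb : b * h = h * b by apply: hc.
have hk : h * k = k * h by apply: kc; rewrite hb.
exists (h * k * (h * k)).
  by apply: pos_sq; rewrite starM sh sk.
have -> : h * k * (h * k) = a * b + (rc e *: (a + b) + K (e * e)).
  rewrite mulrA -[_ * h]mulrA -hk mulrA hh -mulrA kk.
  rewrite mulrDl !mulrDr -!scalerAl -!scalerAr !mulr1 mul1r scalerDr -!addrA.
  by rewrite scalerA -rmorphM.
rewrite opprD addrA subrr add0r nrmN.
have := nrmD (rc e *: (a + b)) (K (e * e)); rewrite nrmK nrmZr.
rewrite (gtr0_norm e0) (gtr0_norm (mulr_gt0 e0 e0)); have := nrmD a b.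
have : e * (nrm a + nrm b + 1) = d by rewrite divfK// gt_eqF// ltr_wpDl// addr_ge0.
nra.
Qed.

(** The commuting factors t - a and t + a have the pos product t^2 - a^2. With g^2 = t^2 - a^2 + e,
    [nrm_sq_le] bounds the norm of a^2 by t^2 + e. *)
Lemma pos_order_nrm a t : star a = a -> 0 <= t ->
  pos (K t - a) -> pos (K t + a) -> nrm a <= t.
Proof.
move=> sa t0 p1 p2.
have aK : a * K t = K t * a by rewrite -scalerAl -scalerAr mul1r mulr1.
have E : (K t - a) * (K t + a) = K (t * t) - a * a.
  by rewrite mulrBl !mulrDr aK KM opprD addrA addrK.
have E' : (K t + a) * (K t - a) = K (t * t) - a * a.
  by rewrite mulrDl !mulrBr aK KM addrA subrK.
have := posM p1 p2; rewrite E E' => /(_ erefl) p.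
rewrite -(@ler_pXn2r _ 2)// ?nnegrE//.
apply: (@ler_addeps _ _ _ 1) => // e e0 _.
have [g [sg gg gc]] := pos_sqrt p e0.
have ag : a * g = g * a.
  by apply: gc; rewrite mulrBl mulrBr -scalerAl -scalerAr mulrA mul1r mulr1.
have := nrm_sq_le sa sg ag.
rewrite gg addrA addrCA subrr addr0 -KD nrmK nrm_saM// ger0_norm; first by rewrite mul1r expr2.
by rewrite addr_ge0 ?mulr_ge0// ltW.
Qed.

Let star_pow a n : star a = a -> star (a ^+ n) = a ^+ n.
Proof.
by move=> sa; elim: n => [|n IH]; rewrite ?expr0// exprS starM IH sa -exprSr exprS.
Qed.

Let nrm_pow k a : star a = a -> nrm (a ^+ (2 ^ k)) = nrm a ^+ (2 ^ k).
Proof.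
move=> sa; elim: k => [|k IH]; first by rewrite expn0 !expr1.
by rewrite expnSr !exprM !expr2 nrm_saM ?star_pow// IH expr2.
Qed.

(** * Positivity of b^* b *)

Lemma pos1 : pos 1.
Proof. by rewrite -K1; apply: posK. Qed.

Lemma posX z n : pos z -> pos (z ^+ n).
Proof.
move=> pz; elim: n => [|n IH]; first by rewrite expr0; exact: pos1.
by rewrite exprS; apply: posM => //; rewrite -exprS exprSr.
Qed.

Lemma pos_expr_lin z n : pos z -> pos (1 - z) ->
  pos (1 - rc n%:R *: (z ^+ n * (1 - z))).
Proof.
move=> pz pz1.
have zc m : (1 - z) * z ^+ m = z ^+ m * (1 - z).
  by rewrite mulrBl mulrBr mul1r mulr1 -exprS exprSr.
(* The stronger bound n z^n (1 - z) <= 1 - z^n carries the induction; its increment is (n + 1) (1 -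
   z) z^n (1 - z). *)
suff H : pos (1 - z ^+ n - rc n%:R *: (z ^+ n * (1 - z))).
  by have := posD H (posX n pz); rewrite addrAC subrK.
elim: n => [|n IH].
  by rewrite expr0 scale0r subrr subr0 -K0; exact: posK.
have pw : pos (z ^+ n * (1 - z)) by apply: posM => //; exact: posX.
have pv : pos ((1 - z) * (z ^+ n * (1 - z))).
  by apply: posM => //; rewrite mulrA zc.
have := posD IH (posZ (ler0n _ n.+1) pv).
set w := z ^+ n * (1 - z).
have -> : z ^+ n.+1 * (1 - z) = z * w by rewrite /w mulrA -exprS.
have -> : z ^+ n.+1 = z ^+ n - w by rewrite /w mulrBr mulr1 -exprSr opprB addrC subrK.
have E : rc n.+1%:R *: w = rc n%:R *: w + w by rewrite -natr1 rmorphD scalerDl scale1r.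
rewrite mulrBl mul1r scalerBr {1}E; congr pos.
by rewrite addrA; congr (_ - _); rewrite addrA subrK opprB addrA addrAC.
Qed.

(* u := t - c^* c and v := t - c c^* satisfy u^n c^* = c^* v^n, so |u^n| is at most s^n up to a
   factor linear in n, while |u^n| = |u|^n along the powers n = 2^k. *)
Lemma ball_swap c t s : 0 < s -> 0 <= t <= s ->
  nrm (K t - c * star c) <= s -> nrm (K t - star c * c) <= s.
Proof.
move=> s0 /andP[t0 ts]; set v := K t - _ => vs; set u := K t - _.
have su : star u = u by rewrite starB starM starK starKt.
have uv n : u ^+ n * star c = star c * v ^+ n.
  elim: n => [|n IH]; first by rewrite !expr0 mul1r mulr1.
  rewrite !exprS -mulrA IH !mulrA; congr (_ * _).
  by rewrite mulrBl mulrBr mulrA -scalerAl -scalerAr mul1r mulr1.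
have vn n : nrm (v ^+ n) <= s ^+ n.
  elim: n => [|n IH]; first by rewrite !expr0 nrm1.
  by rewrite !exprS; apply: le_trans (nrmM _ _) _; apply: ler_pM.
(* The bound on u^n is s^n + n |c|^2 s^(n-1), multiplied by s to avoid the exponent n - 1. *)
apply: (@expr_lin_contra _ _ _ (nrm c ^+ 2)) => [//||k]; first exact: exprn_ge0.
rewrite -nrm_pow//; elim: (2 ^ k)%N => [|n IH].
  by rewrite !expr0 nrm1 mul0r addr0 mul1r mulr1.
have H : nrm (u ^+ n.+1) <= t * nrm (u ^+ n) + nrm c ^+ 2 * s ^+ n.
  have -> : u ^+ n.+1 = rc t *: u ^+ n - star c * v ^+ n * c.
    by rewrite exprSr mulrBr -scalerAr mulr1 mulrA uv.
  apply: le_trans (nrmB _ _) _; rewrite nrmZr ger0_norm// lerD2l.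
  have -> : nrm c ^+ 2 * s ^+ n = nrm c * s ^+ n * nrm c by ring.
  apply: le_trans (nrmM _ _) _; rewrite ler_wpM2r//.
  by apply: le_trans (nrmM _ _) _; rewrite nrm_star ler_wpM2l.
rewrite [s ^+ n.+1]exprS -natr1.
have H1 : nrm (u ^+ n.+1) <= s * nrm (u ^+ n) + nrm c ^+ 2 * s ^+ n.
  by apply: le_trans H _; rewrite lerD2r ler_wpM2r.
have := ler_wpM2l (ltW s0) H1; have := ler_wpM2l (ltW s0) IH; lra.
Qed.

Lemma pos_star_mulD c : pos (star c * c + c * star c).
Proof.
pose h := star c + c; pose k := I *: (c - star c).
have sh : star h = h by rewrite /h starD starK addrC.
have sk : star k = k by rewrite starI starB starK -scalerN opprB.
have half0 : 0 <= 2^-1 :> R by rewrite invr_ge0.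
have := posZ half0 (posD (pos_sq sh) (pos_sq sk)).
congr pos; rewrite /k -scalerAl -scalerAr scalerA (_ : I * I = -1) ?scaleN1r;
  last by rewrite -expr2 sqr_i.
rewrite /h mulrBl !mulrBr !mulrDl !mulrDr.
set x := star c * star c; set y := star c * c; set z := c * star c; set w := c * c.
rewrite !opprB addrACA [x + y]addrC [y + x + _]addrACA subrr addr0.
rewrite [z + w + _]addrACA subrr addr0 addrACA -mulr2n -scaler_nat scalerA.
by rewrite fmorphV rmorph_nat mulVf ?pnatr_eq0// scale1r.
Qed.

(* If a := b^* b is not pos, then |t - a| > t for t := |a|; put z := (t - a) / |t - a|. High powers
   z^n concentrate on the negative part of a, so c := b z^(n/2) has c^* c <= O(1/n). As
   c^* c + c c^* is pos, c c^* >= - O(1/n), hence c^* c >= - O(1/n) by ball_swap; this forces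
   z^n = O(1/n) although |z| = 1. *)
Theorem pos_star_mul b : pos (star b * b).
Proof.
pose a := star b * b; rewrite -/a; pose t := nrm a.
have sa : star a = a by rewrite starM starK.
have t0 : 0 <= t by exact: nrm_ge0.
have [at_|tr] := leP (nrm (K t - a)) t; first by split=> //; exists t.
pose r := nrm (K t - a); have r0 : 0 < r by apply: le_lt_trans tr.
have rr : rc r * rc r^-1 = 1 by rewrite -rmorphM divff// gt_eqF.
have rV0 : 0 <= r^-1 by rewrite invr_ge0 ltW.
pose z := rc r^-1 *: (K t - a); pose d := 1 - t / r.
have d0 : 0 < d by rewrite subr_gt0 ltr_pdivrMr// mul1r.
have pz : pos z by apply: posZ => //; apply: pos_ball.
have [sz _] := pz.
have z1 : nrm z = 1 by rewrite nrmZr ger0_norm// mulVf// gt_eqF.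
have pz1 : pos (1 - z) by rewrite -K1; apply: pos_ball; rewrite ?z1.
have az : a = rc r *: (1 - z - K d).
  rewrite /d KB K1 opprB [1 - z]addrC addrACA subrr addr0 scalerDr scalerN.
  rewrite 2!scalerA rr scale1r -rmorphM mulrC divfK ?gt_eqF//.
  by rewrite opprB subrK.
(* Letting k grow contradicts d > 0. The exponent n is 2 N so that c = b z^N gives c^* c = z^N a z^N
   = r (z^n (1 - z) - d z^n). *)
have H k : d * 2 ^+ k <= 1.
  pose N := (2 ^ k)%N; pose n := (2 ^ k.+1)%N.
  have nN : n = (N + N)%N by rewrite /n expnS mul2n addnn.
  have n0 : 0 < n%:R :> R by rewrite ltr0n expn_gt0.
  have nV0 : 0 <= n%:R^-1 :> R by rewrite invr_ge0 ltW.
  pose c := b * z ^+ N; pose w := z ^+ n * (1 - z).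
  have zN : star (z ^+ N) = z ^+ N by rewrite star_pow.
  have P1 : pos (K n%:R^-1 - w).
    have := posZ nV0 (pos_expr_lin n pz pz1).
    by rewrite scalerBr scalerA -rmorphM mulVf ?gt_eqF// scale1r.
  have cc : star c * c = rc r *: (w - rc d *: z ^+ n).
    rewrite starM zN mulrA -(mulrA _ (star b)) -/a az -scalerAr -scalerAl; congr (_ *: _).
    have zc : (1 - z - K d) * z ^+ N = z ^+ N * (1 - z - K d).
      rewrite !mulrBl !mulrBr mul1r mulr1 -exprS exprSr.
      by rewrite mulKl mulKr.
    rewrite -mulrA zc mulrA -exprD -nN mulrBr; congr (_ - _).
    exact: mulKr.
  have P2 : pos (K (r / n%:R) - star c * c).
    have := posZ (ltW r0) (posD P1 (posZ (ltW d0) (posX n pz))).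
    rewrite cc; have -> : K (r / n%:R) = rc r *: K n%:R^-1 by rewrite scalerA -rmorphM.
    by rewrite -scalerBr opprB -addrA [- w + _]addrC.
  have P3 : pos (c * star c + K (r / n%:R)).
    have := posD (pos_star_mulD c) P2.
    by congr pos; rewrite addrC addrA subrK addrC.
  have rn0 : 0 <= r / n%:R by rewrite divr_ge0// ltW.
  have P4 : pos (star c * c + K (r / n%:R)).
    (* Subtracting c c^* + r/n from t' + r/n leaves t' - c c^*; so [P3] bounds this norm by t' +
       r/n, and [ball_swap] carries the bound over to t' - c^* c. *)
    pose t' := nrm (c * star c) + 1.
    have t'0 : 0 < t' by rewrite ltr_wpDl.
    have E x : K (t' + r / n%:R) - (x + K (r / n%:R)) = K t' - x.
      by rewrite KD opprD addrACA subrr addr0.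
    split; first by rewrite starD starM starK starKt.
    exists (t' + r / n%:R); first by rewrite addr_ge0// ltW.
    rewrite E; apply: ball_swap; first by rewrite ltr_wpDr.
      by rewrite ltW// lerDl.
    rewrite -E; apply: pos_nrm_ball => //.
    apply: le_lt_trans (nrmD _ _) _; rewrite nrmK ger0_norm//.
    by rewrite ltrD2r ltrDl.
  have P5 : pos (w - rc d *: z ^+ n + K n%:R^-1).
    have := posZ rV0 P4.
    rewrite cc scalerDr !scalerA -!rmorphM mulVf ?gt_eqF// scale1r.
    by rewrite mulrA mulVf ?gt_eqF// mul1r.
  have P6 : pos (K (2 / n%:R) - rc d *: z ^+ n).
    have := posD P1 P5; congr pos.
    rewrite [_ - w]addrC addrACA addKr addrC -KD.
    by congr (K _ - _); lra.
  have P7 : pos (K (2 / n%:R) + rc d *: z ^+ n).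
    apply: posD; first by apply: posK; rewrite divr_ge0// ltW.
    by apply: posZ; [exact: ltW|exact: posX].
  have n2 : 0 <= 2 / n%:R :> R by rewrite divr_ge0// ltW.
  (* The norm of z^n is 1 because n is a power of two, hence d <= 2/n = 2^-k. *)
  have := pos_order_nrm _ n2 P6 P7; rewrite starZr star_pow// => /(_ erefl).
  rewrite nrmZr (gtr0_norm d0) nrm_pow// z1 expr1n mulr1 ler_pdivlMr//.
  rewrite natrX exprS; lra.
have [||k] := @expr_small _ 2^-1 d; [lra|by []|].
by rewrite exprVn ltNge -div1r ler_pdivlMr ?exprn_gt0// H.
Qed.

(** * States that detect the norm *)

Local Notation re x := (rc 2^-1 *: (x + star x)).

Let star_re x : star (re x) = re x.
Proof. by rewrite starZr starD starK addrC. Qed.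

Let halfK (x : A) : rc 2^-1 *: (x + x) = x.
Proof.
rewrite -mulr2n -scaler_nat scalerA.
by rewrite fmorphV rmorph_nat mulVf ?pnatr_eq0// scale1r.
Qed.

Let mulII : I * I = -1. Proof. by rewrite -expr2 sqr_i. Qed.

Let re_decomp x : x = re x - I *: re (I *: x).
Proof.
have -> : I *: re (I *: x) = rc 2^-1 *: (star x - x).
  rewrite starI -scalerBr scalerA mulrC -scalerA [I *: (I *: _)]scalerA mulII.
  by rewrite scaleN1r opprB.
by rewrite -scalerBr opprB addrACA subrr addr0 halfK.
Qed.

(** With m the norm of h, one of m + h and m - h has norm 2 m. A functional attaining that norm must
    take its largest possible values on both summands, which gives 1 at the unit. *)
Lemma exists_functional h : star h = h -> exists f : A -> R,
  [/\ (forall x y, f (x + y) = f x + f y), (forall r x, f (rc r *: x) = r * f x),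
      (forall x, f x <= nrm x), f 1 = 1 & `|f h| = nrm h].
Proof.
move=> sh.
have ns : sublinear nrm.
  by split=> [x y|r x r0]; [exact: nrmD|rewrite nrmZr gtr0_norm].
pose m := nrm h; have m0 : 0 <= m by exact: nrm_ge0.
have fN (f : A -> R) x : (forall r x, f (rc r *: x) = r * f x) -> f (- x) = - f x.
  by move=> fZ; rewrite -scaleN1r -[-1]/(- (rc 1)) -rmorphN fZ mulN1r.
move: m0; rewrite le_eqVlt => /orP[/eqP mE|m0].
  have [f [fD fZ fn f1]] := hahn_banach 1 ns.
  exists f; split=> //; first by rewrite f1.
  by have := nrm_eq0 (esym mE) => ->; rewrite -K0 fZ mul0r normr0 K0 nrm0.
have [g [sg ng gh]] : exists g, [/\ star g = g, nrm g = m, g = h \/ g = - h &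
    2 * m <= nrm (K m + g)].
  have [H|H1] := leP (2 * m) (nrm (K m + h)); first by exists h; split=> //; left.
  have [H|H2] := leP (2 * m) (nrm (K m - h)).
    by exists (- h); split=> //; rewrite ?starN ?sh ?nrmN//; right.
  (* Otherwise rho - m - h and rho - m + h are both pos, so h has norm at most rho - m < m. *)
  exfalso; pose rho := Num.max (nrm (K m + h)) (nrm (K m - h)).
  have r1 : nrm (K m + h) <= rho by rewrite le_max lexx.
  have r2 : nrm (K m - h) <= rho by rewrite le_max lexx orbT.
  have r3 : rho < 2 * m by rewrite gt_max H1.
  have rm : m <= rho.
    have := nrmD (K m + h) (K m - h); rewrite addrACA subrr addr0 -KD nrmK.
    rewrite ger0_norm; last by rewrite addr_ge0// ltW.
    lra.
  have rho0 : 0 <= rho by apply: le_trans rm; exact: ltW.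
  have sp : star (K m + h) = K m + h by rewrite starD starKt sh.
  have sm : star (K m - h) = K m - h by rewrite starB starKt sh.
  have p1 := pos_ball rho0 sp r1; have p2 := pos_ball rho0 sm r2.
  have rm0 : 0 <= rho - m by rewrite subr_ge0.
  have := pos_order_nrm sh rm0; rewrite KB.
  move: p1 p2; rewrite !opprD !addrA opprK => p1 p2 /(_ p1 p2).
  by rewrite -/m; lra.
move=> Hg; have [f [fD fZ fn f1]] := hahn_banach (K m + g) ns.
have fK : f (K m) = m * f 1 by rewrite fZ.
have f1' := fn 1; rewrite nrm1 in f1'.
have fg := fn g; rewrite ng in fg.
have E : m * f 1 + f g = nrm (K m + g) by rewrite -fK -fD.
have mf : m * f 1 <= m by rewrite ler_piMr// ltW.
have f11 : f 1 = 1.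
  by apply: (mulfI (lt0r_neq0 m0)); rewrite mulr1; lra.
have fgm : f g = m by rewrite f11 in E; lra.
exists f; split=> //; case: gh => gE; first by rewrite -gE fgm ger0_norm// ltW.
by rewrite -[h]opprK -gE fN// normrN nrmN fgm ng ger0_norm// ltW.
Qed.

Lemma exists_state x : exists2 mu : A -> R[i],
  is_state star setT mu & nrm (re x) <= cabs (mu x).
Proof.
have [f [fD fZ fn f1 fh]] := exists_functional (star_re x).
pose g y := f (re y).
have gD y z : g (y + z) = g y + g z by rewrite /g starD addrACA scalerDr fD.
have gZ r y : g (rc r *: y) = r * g y.
  by rewrite /g starZr -scalerDr scalerA mulrC -scalerA fZ.
have gN y : g (- y) = - g y.
  by rewrite -scaleN1r -[-1]/(- (rc 1)) -rmorphN gZ mulN1r.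
(* g is real-linear, and g y - i g(iy) is its complexification. *)
exists (fun y => Complex (g y) (- g (I *: y))); last first.
  rewrite -fh /cabs /= -sqrtr_sqr; apply: ler_wsqrtr.
  by rewrite lerDl sqr_ge0.
split=> [a b _ _|c a _||a _ [b ->]].
- by rewrite scalerDr !gD opprD.
- case: c => u v.
  have cE : Complex u v = rc u + rc v * I.
    by apply/eqP; rewrite eq_complex /= !(mul0r, mulr0, mulr1, subr0, addr0, add0r) !eqxx.
  have E1 : Complex u v *: a = rc u *: a + rc v *: (I *: a).
    by rewrite cE scalerDl -scalerA.
  have E2 : I *: (Complex u v *: a) = rc u *: (I *: a) - rc v *: a.
    rewrite E1 scalerDr !scalerA [I * rc u]mulrC [I * _]mulrC -mulrA mulII mulrN1 scaleNr.
    by [].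
  rewrite E2 E1 !gD gN !gZ; apply/eqP; rewrite eq_complex /=.
  by apply/andP; split; apply/eqP; ring.
- have -> : g 1 = 1 by rewrite /g star1 halfK f1.
  have -> : g (I *: 1) = 0.
    by rewrite /g starI star1 subrr scaler0 -K0 fZ mul0r.
  by rewrite oppr0.
- have sb : star (star b * b) = star b * b by rewrite starM starK.
  have -> : g (I *: (star b * b)) = 0.
    by rewrite /g starI sb subrr scaler0 -K0 fZ mul0r.
  rewrite oppr0 lecE /= eqxx /= /g sb halfK.
  (* t - f (b^* b) = f (t - b^* b) is at most the norm of t - b^* b, hence at most t. *)
  have [_ [t t0]] := pos_star_mul b.
  have := fn (K t - star b * b); rewrite fD fZ f1.
  have -> : f (- (star b * b)) = - f (star b * b).
    by rewrite -scaleN1r -[-1]/(- (rc 1)) -rmorphN fZ mulN1r.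
  lra.
Qed.

(** The factor 2 comes from x = re x - i re (i x), with one state for each part; states of the whole
    algebra restrict to P. *)
Lemma nrm_le_states P x e :
  (forall nu, is_state star P nu -> cabs (nu x) <= e) -> nrm x <= 2 * e.
Proof.
move=> H.
have [mu smu mux] := exists_state x.
have [nu snu nux] := exists_state (I *: x).
have toP m : is_state star setT m -> is_state star P m.
  by move=> [mD mZ m1 mp]; split=> // *; [exact: mD|exact: mZ|exact: mp].
have nuI : cabs (nu (I *: x)) = cabs (nu x).
  case: snu => _ -> // _ _; rewrite /cabs Normc.normcM.
  by rewrite -/(cabs I) cabs_I mul1r.
have := H _ (toP _ smu); have := H _ (toP _ snu); rewrite -nuI.
have := nrmB (re x) (I *: re (I *: x)); rewrite -re_decomp (nrmZ I) cabs_I mul1r.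
lra.
Qed.

(** Passes from norms to the algebraic positivity that states respect; the strict inequality leaves
    room for the shift in [pos_sqrt]. *)
Lemma positive_K_sub h t : star h = h -> nrm h < t -> positive star (K t - h).
Proof.
move=> sh ht.
have e0 : 0 < t - nrm h by rewrite subr_gt0.
have [k [sk kk _]] := pos_sqrt (pos_ball (nrm_ge0 h) sh (lexx _)) e0.
by exists k; rewrite sk kk [RHS]addrAC -KD [nrm h + _]addrC subrK.
Qed.

(** * Boundedness of states and weak* compactness of the state space *)

Section States.
Variable P : set A.
Hypothesis HP : dense_unital_star_subalgebra star nrm P.

Let P1 : P 1. Proof. by case: HP. Qed.
Let PD a b : P a -> P b -> P (a + b). Proof. by case: HP => _ [H _] _ _ _; exact: H. Qed.
Let PZ c a : P a -> P (c *: a). Proof. by case: HP => _ [_ H] _ _ _; exact: H. Qed.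
Let Pstar a : P a -> P (star a). Proof. by case: HP => _ _ _ H _; exact: H. Qed.
Let PN a : P a -> P (- a). Proof. by rewrite -(scaleN1r a); exact: PZ. Qed.

Lemma state_sa_bound nu h : is_state star P nu -> P h -> star h = h ->
  cabs (nu h) <= nrm h.
Proof.
move=> [nuD nuZ nu1 nup] Ph sh.
have H g t : P g -> star g = g -> nrm g < t -> complex.Im (nu g) = 0 /\ complex.Re (nu g) <= t.
  move=> Pg sg gt.
  have := nup (K t - g) (PD (PZ _ P1) (PN Pg)) (positive_K_sub sg gt).
  rewrite nuD; [|exact: PZ|exact: PN].
  rewrite -(scaleN1r g) !nuZ// nu1 mulr1 mulN1r lecE /=.
  case: (nu g) => u v /=; rewrite sub0r subr_ge0 oppr_eq0 => /andP[/eqP -> ->].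
  by [].
apply: (@ler_addeps _ _ _ 1) => // e e0 _; rewrite mul1r.
have ht : nrm h < nrm h + e by rewrite ltrDl.
have [I0 R1] := H h _ Ph sh ht.
have [||_] := H (- h) (nrm h + e) (PN Ph); rewrite ?starN ?sh ?nrmN//.
rewrite -(scaleN1r h) nuZ// mulN1r.
move=> R2; apply: le_trans (cabs_le_ReIm _) _; rewrite I0 normr0 addr0.
move: R1 R2; case: (nu h) => u v /= R1 R2; rewrite ler_norml; lra.
Qed.

Lemma nrm_re_le x : nrm (re x) <= nrm x.
Proof.
by rewrite nrmZr ger0_norm ?invr_ge0//; have := nrmD x (star x); rewrite nrm_star; lra.
Qed.

Lemma state_bound nu x : is_state star P nu -> P x -> cabs (nu x) <= 2 * nrm x.
Proof.
move=> snu Px; have [nuD nuZ nu1 nup] := snu.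
have Pre y : P y -> P (re y) by move=> Py; apply/PZ/PD => //; exact: Pstar.
have PIx : P (I *: x) by exact: PZ.
have E : nu x = nu (re x) - I * nu (re (I *: x)).
  rewrite {1}[x]re_decomp -scaleNr.
  by rewrite (nuD _ _ (Pre _ Px) (PZ _ (Pre _ PIx))) (nuZ _ _ (Pre _ PIx)) mulNr.
rewrite E; apply: le_trans (cabsD _ _) _; rewrite cabsN cabsM cabs_I mul1r.
have := state_sa_bound snu (Pre _ Px) (star_re x).
have := state_sa_bound snu (Pre _ PIx) (star_re _).
have := nrm_re_le x; have := nrm_re_le (I *: x); rewrite (nrmZ I) cabs_I mul1r; lra.
Qed.

(** Values at each a in P are bounded by [state_bound], so they converge along F, and the conditions
    defining a state pass to limits. *)
Lemma state_ultra_lim (F : set_system (A -> R[i])) : UltraFilter F ->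
  F [set nu | is_state star P nu] ->
  exists2 mu, is_state star P mu &
    forall a e, P a -> 0 < e -> F [set nu | cabs (nu a - mu a) < e].
Proof.
move=> FU FS.
have ex a : exists l : R[i], P a -> forall e, 0 < e -> F [set nu | cabs (nu a - l) < e].
  (* Off P the limit takes the default value 0, since values there are irrelevant. *)
  have [Pa|nPa] := pselect (P a); last by exists 0.
  have [|u Hu] := @ultra_bounded_lim R _ F (fun nu => complex.Re (nu a)) (2 * nrm a) FU.
    by apply: filterS FS => nu /state_bound/(_ Pa); apply: le_trans (Re_le_cabs _).
  have [|v Hv] := @ultra_bounded_lim R _ F (fun nu => complex.Im (nu a)) (2 * nrm a) FU.
    by apply: filterS FS => nu /state_bound/(_ Pa); apply: le_trans (Im_le_cabs _).
  exists (Complex u v) => _ e e0; have e2 : 0 < e / 2 by rewrite divr_gt0.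
  apply: filterS (filterI (Hu _ e2) (Hv _ e2)) => nu [/= H1 H2].
  apply: le_lt_trans (cabs_le_ReIm _) _.
  by move: H1 H2; case: (nu a) => x y /=; lra.
have [mu Hmu] := choice ex.
have small (z : R[i]) (c : R) : 0 <= c -> (forall e : R, 0 < e ->
    F [set nu | is_state star P nu -> cabs z <= c * e]) -> z = 0.
  move=> c0 H; apply: (@cabs_small _ z c c0) => e e0.
  by have [nu [/= + snu]] := filter_ex (filterI (H e e0) FS); apply.
exists mu; last by move=> a e Pa e0; exact: Hmu.
split.
- move=> a b Pa Pb; apply/eqP; rewrite -subr_eq0; apply/eqP.
  apply: (small _ 3) => // e e0.
  have Hab := Hmu _ (PD Pa Pb) e e0.
  apply: filterS (filterI Hab (filterI (Hmu _ Pa e e0) (Hmu _ Pb e e0))).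
  move=> nu [/= H1 [H2 H3]] [nuD _ _ _]; rewrite nuD// in H1.
  have -> : mu (a + b) - (mu a + mu b) =
      - (nu a + nu b - mu (a + b)) + ((nu a - mu a) + (nu b - mu b)) by ring.
  have := cabsD (- (nu a + nu b - mu (a + b))) ((nu a - mu a) + (nu b - mu b)).
  have := cabsD (nu a - mu a) (nu b - mu b); rewrite cabsN; lra.
- move=> c a Pa; apply/eqP; rewrite -subr_eq0; apply/eqP.
  have c0 : 0 <= cabs c by exact: cabs_ge0.
  apply: (small _ (1 + cabs c)) => [|e e0]; first by rewrite addr_ge0.
  apply: filterS (filterI (Hmu _ (PZ c Pa) e e0) (Hmu _ Pa e e0)).
  move=> nu [/= H1 H2] [_ nuZ _ _]; rewrite nuZ// in H1.
  have -> : mu (c *: a) - c * mu a = - (c * nu a - mu (c *: a)) + c * (nu a - mu a) by ring.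
  apply: le_trans (cabsD _ _) _; rewrite cabsN cabsM mulrDl mul1r.
  by rewrite lerD ?ler_wpM2l// ltW.
- apply/eqP; rewrite -subr_eq0; apply/eqP; apply: (small _ 1) => // e e0.
  apply: filterS (Hmu _ P1 e e0) => nu /= H [_ _ nu1 _].
  by rewrite nu1 in H; rewrite -cabsN opprB mul1r ltW.
move=> a Pa pa.
have key e : 0 < e -> `|complex.Im (mu a)| <= e /\ - e <= complex.Re (mu a).
  move=> e0; have [nu [/= H [_ _ _ /(_ a Pa pa)]]] := filter_ex (filterI (Hmu _ Pa e e0) FS).
  rewrite lecE /= => /andP[].
  have := le_lt_trans (Re_le_cabs _) H; have := le_lt_trans (Im_le_cabs _) H.
  case: (nu a) (mu a) => [u v] [u' v'] /= H1 H2 /eqP v0 u0.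
  move: H1 H2; rewrite v0 sub0r normrN => /ltW -> ; rewrite ltr_norml => /andP[_ H2].
  by split=> //; lra.
have Im0 : complex.Im (mu a) = 0.
  apply/eqP; rewrite -normr_le0.
  by apply: (@ler_addeps _ _ _ 1) => // e /key[+ _] _; rewrite add0r mul1r.
have Re0 : 0 <= complex.Re (mu a).
  by apply: (@ler_addeps _ _ _ 1) => // e /key[_ +] _; lra.
by rewrite lecE /= Im0 eqxx.
Qed.

(** If no finite family of the V mu covers, their complements generate a proper filter. An
    ultrafilter above it converges to a state mu and contains both V mu and its complement. *)
Lemma state_space_compact (V : (A -> R[i]) -> set (A -> R[i])) :
  (forall mu, is_state star P mu -> weakstar_nbhd star P mu (V mu)) ->
  exists2 l : seq (A -> R[i]), forall mu, mu \in l -> is_state star P mu &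
    forall nu, is_state star P nu -> exists2 mu, mu \in l & V mu nu.
Proof.
move=> Vn; apply: contrapT => noc.
pose F0 : set_system (A -> R[i]) := [set W | exists2 l : seq (A -> R[i]),
  forall mu, mu \in l -> is_state star P mu &
  forall nu, is_state star P nu -> (forall mu, mu \in l -> ~ V mu nu) -> W nu].
have F0P : ProperFilter F0.
  split; last split.
  - move=> [l ls lW]; apply: noc; exists l => // nu snu.
    apply: contrapT => H; apply: (lW nu snu) => mu mul Vm.
    by apply: H; exists mu.
  - by exists [::].
  - move=> W1 W2 [l1 s1 H1] [l2 s2 H2]; exists (l1 ++ l2).
      by move=> mu; rewrite mem_cat => /orP[/s1|/s2].
    move=> nu snu H; split.
      by apply: H1 => // mu mul; apply: H; rewrite mem_cat mul.
    by apply: H2 => // mu mul; apply: H; rewrite mem_cat mul orbT.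
  - move=> W1 W2 W12 [l s1 H1]; exists l => // nu snu H.
    exact/W12/H1.
have [F [FU F0F]] := ultraFilterLemma F0P.
have FS : F [set nu | is_state star P nu] by apply: F0F; exists [::].
have [mu smu Hmu] := state_ultra_lim FU FS.
have [s [e [sP e0 sV]]] := Vn mu smu.
have Fs : F [set nu | forall a, a \in s -> cabs (nu a - mu a) < e].
  elim: s sP {sV} => [|a s IH] sP; first by apply: filterS FS.
  have Pa : P a by apply: sP; rewrite mem_head.
  have {}IH : F [set nu | forall b, b \in s -> cabs (nu b - mu b) < e].
    by apply: IH => b bs; apply: sP; rewrite inE bs orbT.
  apply: filterS (filterI (Hmu a e Pa e0) IH) => nu [/= H1 H2] b.
  by rewrite inE => /orP[/eqP ->|/H2].
have FV : F (~` V mu).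
  apply: F0F; exists [:: mu] => [nu|nu _].
    by rewrite mem_seq1 => /eqP ->.
  by apply; rewrite mem_head.
have [nu [[H1 H2]]] := filter_ex (filterI (filterI Fs FS) FV).
by apply; exact: sV.
Qed.
End States.

(** * An inner product bound in the Hilbert module *)

Section HilbertModule.
Variables (X : lmodType R[i]) (act : X -> A -> X) (ip : X -> X -> A).
Hypothesis HX : right_hilbert_module star nrm act ip.

Let ip_star x y : ip y x = star (ip x y).
Proof. by case: HX => _ _ _ H _; exact: H. Qed.
Let ipDr x y z : ip x (y + z) = ip x y + ip x z.
Proof. by case: HX => _ [H _] _ _ _; exact: H. Qed.
Let ipZr c x y : ip x (c *: y) = c *: ip x y.
Proof. by case: HX => _ [_ H] _ _ _; exact: H. Qed.
Let ipDl x y z : ip (x + y) z = ip x z + ip y z.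
Proof. by rewrite ip_star ipDr starD -!ip_star. Qed.
Let ip_pos x : pos (ip x x).
Proof. by case: HX => _ _ _ _ [H _ _]; have [b ->] := H x; exact: pos_star_mul. Qed.

(** Positivity of the inner squares of z + x and z - x bounds the cross term on both sides, and
    [pos_order_nrm] turns this into a norm bound. *)
Let nrm_ip_reD z x : nrm (ip z x + star (ip z x)) <= nrm (ip z z) + nrm (ip x x).
Proof.
have T0 : 0 <= nrm (ip z z) + nrm (ip x x) by rewrite addr_ge0.
have H y : ip y y = ip x x ->
    pos (K (nrm (ip z z) + nrm (ip x x)) + (ip z y + star (ip z y))).
  move=> yx; have [sz _] := ip_pos z; have [sx _] := ip_pos x.
  have := posD (ip_pos (z + y)) (posD (pos_ball (nrm_ge0 _) sz (lexx _))
                                      (pos_ball (nrm_ge0 _) sx (lexx _))).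
  congr pos; rewrite ipDl !ipDr (ip_star z y) yx KD.
  set p := ip z z; set q := ip x x; set w := ip z y.
  rewrite [star w + q]addrC [p + w + _]addrACA [K _ - p + _]addrACA -opprD.
  by rewrite [LHS]addrC [LHS]addrA subrK.
apply: pos_order_nrm => //; first by rewrite starD starK addrC.
  have ipN y : ip z (- y) = - ip z y by rewrite -(scaleN1r y) ipZr scaleN1r.
  have NN : ip (- x) (- x) = ip x x.
    by rewrite -(scaleN1r x) ipZr ip_star ipZr !scaleN1r starN opprK -ip_star.
  by have := H (- x) NN; rewrite ipN starN -opprD.
exact: H.
Qed.

(** An additive substitute for the Cauchy-Schwarz inequality, enough for boundedness; the two parts
    of the inner product come from x and i x. *)
Lemma nrm_ip_le z x : nrm (ip z x) <= nrm (ip z z) + nrm (ip x x).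
Proof.
have re_le y : nrm (re (ip z y)) <= (nrm (ip z z) + nrm (ip y y)) / 2.
  by rewrite nrmZr ger0_norm ?invr_ge0// mulrC ler_wpM2r ?invr_ge0// nrm_ip_reD.
have Ix : ip (I *: x) (I *: x) = ip x x.
  rewrite ipZr ip_star ipZr starI scalerN scalerA mulII scaleN1r opprK.
  by rewrite -ip_star.
have := re_le x; have := re_le (I *: x); rewrite Ix ipZr.
have := nrmB (re (ip z x)) (I *: re (I *: ip z x)); rewrite -re_decomp (nrmZ I) cabs_I mul1r.
lra.
Qed.
End HilbertModule.

End CStarAlgebra.

(** * Total boundedness from the frame *)

Theorem theorem3p8 (R : realType)
  (A0 : algType R[i]) (star : A0 -> A0) (nrmA : A0 -> R) (PA : set A0)
  (X : lmodType R[i]) (act : X -> A0 -> X) (ip : X -> X -> A0) (PX : set X)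
  (L : X -> R) (L0 : A0 -> R) (n : nat) (zeta : 'I_n -> X) :
  unital_cstar_algebra star nrmA ->
  dense_unital_star_subalgebra star nrmA PA ->
  right_hilbert_module star nrmA act ip ->
  dense_compatible_subspace nrmA act ip PA PX ->
  seminorm_on PX L ->
  slip_norm star PA L0 ->
  compact_quantum_metric_space star PA L0 ->
  finite_frame act ip PX zeta ->
  (exists2 C : R, 0 <= C &
     forall x, PX x -> hilbert_module_norm nrmA ip x <= C * L x) ->
  (exists2 C0 : R, 0 <= C0 &
     forall x (j : 'I_n), PX x ->
       L0 (ip (zeta j) x) <= C0 * (L x + hilbert_module_norm nrmA ip x)) ->
  totally_bounded (hilbert_module_norm nrmA ip) [set x | PX x /\ L x <= 1].
Proof.
move=> HA HP HX [PX0 [PXD PXZ] _ _ PXip] [L_ge0 LD LZ] [[L0_ge0 L0D L0Z] _ _] cqms.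
move=> [zP frame] [C C0 LC] [C1 C10 LC1] e e0.
set S := [set x | _].
have PXN x : PX x -> PX (- x) by rewrite -scaleN1r; exact: PXZ.
pose d j x := ip (zeta j) x.
pose M j := nrmA (ip (zeta j) (zeta j)) + C ^+ 2.
have nrm_ge0 a : 0 <= nrmA a by case: HA => _ [H _ _ _] _ _ _; exact: H.
have ipDr x y z : ip x (y + z) = ip x y + ip x z.
  by case: HX => _ [H _] _ _ _; exact: H.
have ipZr c x y : ip x (c *: y) = c *: ip x y.
  by case: HX => _ [_ H] _ _ _; exact: H.
have ipBr x y z : ip x (y - z) = ip x y - ip x z.
  by rewrite ipDr -(scaleN1r z) ipZr scaleN1r.
have S_C x : S x -> hilbert_module_norm nrmA ip x <= C.
  by move=> [Px Lx]; apply: le_trans (LC x Px) _; rewrite ler_piMr.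
have d_bd j x : S x -> nrmA (d j x) <= M j.
  move=> Sx; apply: le_trans (nrm_ip_le HA HX _ _) _; rewrite lerD2l.
  have := S_C x Sx; rewrite -(@ler_pXn2r _ 2)// ?nnegrE ?sqrtr_ge0//.
  by rewrite sqr_sqrtr.
have d_P j x : S x -> PA (d j x) by move=> [Px _]; apply: PXip.
(* C1 (1 + C) bounds L0 of the frame coefficients on S; adding 1 makes r invertible. *)
pose r : R := C1 * (1 + C) + 1.
have r0 : 0 < r by rewrite ltr_wpDl// mulr_ge0// addr_ge0.
have d_L j x : S x -> L0 (d j x) <= r.
  move=> Sx; have [Px Lx] := Sx; apply: le_trans (LC1 x j Px) _.
  have : C1 * (L x + hilbert_module_norm nrmA ip x) <= C1 * (1 + C).
    by apply: ler_wpM2l => //; apply: lerD => //; exact: S_C.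
  rewrite /r; lra.
(* The final sum is n (2 eta)^2 < ((n + 1) 2 eta)^2 = e^2; n + 1 also covers n = 0. *)
pose eta : R := e / (2 * n.+1%:R).
have eta0 : 0 < eta by rewrite divr_gt0// mulr_gt0// ltr0n.
(* Moving from nu to a centre, from x to y, and back to nu costs r dl + 2 dl + r dl = eta. *)
pose dl : R := eta / (2 * r + 2).
have dl0 : 0 < dl by rewrite divr_gt0// addr_gt0// mulr_gt0.
have etaE : eta = dl * (2 * r + 2) by rewrite /dl divfK// gt_eqF// addr_gt0// mulr_gt0.
have [|l ls lcov] := @state_space_compact _ _ _ _ HA _ HP
    (fun mu nu => is_state star PA nu /\ (mk_dist PA L0 mu nu < dl%:E)%E).
  move=> mu smu; apply/(cqms mu smu); exists dl => // nu snu nud; by split.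
pose gs : seq (X -> R) :=
  [seq (fun x => complex.Re (mu (d j x))) | mu <- l, j <- enum 'I_n] ++
  [seq (fun x => complex.Im (mu (d j x))) | mu <- l, j <- enum 'I_n].
have [|s Hs] := @finite_net _ _ gs S dl dl0.
  move=> g; rewrite mem_cat => /orP[] /allpairsP[[mu j] /= [mul _ ->]].
    exists (2 * M j) => x Sx; apply: le_trans (Re_le_cabs _) _.
    apply: le_trans (state_bound HA HP (ls mu mul) (d_P j x Sx)) _.
    by rewrite ler_wpM2l// d_bd.
  exists (2 * M j) => x Sx; apply: le_trans (Im_le_cabs _) _.
  apply: le_trans (state_bound HA HP (ls mu mul) (d_P j x Sx)) _.
  by rewrite ler_wpM2l// d_bd.
exists s => x Sx; have [y [ys Sy net]] := Hs x Sx; exists y => //.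
have near mu j : mu \in l -> cabs (mu (d j x) - mu (d j y)) <= 2 * dl.
  move=> mul; apply: le_trans (cabs_le_ReIm _) _.
  have H1 := net (fun x => complex.Re (mu (d j x))).
  have H2 := net (fun x => complex.Im (mu (d j x))).
  have {}H1 : `|complex.Re (mu (d j x)) - complex.Re (mu (d j y))| < dl.
    apply: H1; rewrite mem_cat; apply/orP; left.
    by apply/allpairsP; exists (mu, j); rewrite /= mem_enum.
  have {}H2 : `|complex.Im (mu (d j x)) - complex.Im (mu (d j y))| < dl.
    apply: H2; rewrite mem_cat; apply/orP; right.
    by apply/allpairsP; exists (mu, j); rewrite /= mem_enum.
  by move: H1 H2; case: (mu (d j x)) (mu (d j y)) => [u v] [u' v'] /=; lra.
have lip mu nu j z : is_state star PA mu -> is_state star PA nu ->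
    (mk_dist PA L0 mu nu < dl%:E)%E -> S z ->
    cabs (mu (d j z) - nu (d j z)) <= r * dl.
  move=> [_ muZ _ _] [_ nuZ _ _] mn Sz.
  have Pd := d_P j z Sz.
  (* Scaling by 1/r puts the coefficient into the unit ball of L0, over which [mk_dist] is a
     supremum. *)
  pose b := real_complex R r^-1 *: d j z.
  have Pb : PA b.
    by case: HP => _ [_ H] _ _ _; exact: H.
  have Lb : L0 b <= 1.
    rewrite L0Z// cabs_real ger0_norm ?invr_ge0 ?(ltW r0)//.
    by rewrite ler_pdivrMl// mulr1 d_L.
  have : ((cabs (mu b - nu b))%:E <= mk_dist PA L0 mu nu)%E.
    by apply: ereal_sup_ubound; exists b.
  move=> /le_lt_trans/(_ mn); rewrite lte_fin muZ// nuZ// -mulrBr cabsM cabs_real.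
  rewrite ger0_norm ?invr_ge0 ?(ltW r0)// ltr_pdivrMl// => /ltW.
  by [].
have djxy j : nrmA (d j (x - y)) <= 2 * eta.
  apply: (nrm_le_states HA (P := PA)) => nu snu.
  have [mu mul [_ mn]] := lcov nu snu.
  have smu := ls mu mul.
  have -> : nu (d j (x - y)) = nu (d j x) - nu (d j y).
    have [nuD nuZ _ _] := snu.
    have PN : PA (-1 *: d j y) by case: HP => _ [_ H] _ _ _; exact/H/d_P.
    rewrite /d ipBr -(scaleN1r (ip _ y)) nuD ?nuZ ?mulN1r//; exact: d_P.
  have := lip mu nu j x smu snu mn Sx; have := lip mu nu j y smu snu mn Sy.
  have := near mu j mul.
  have -> : nu (d j x) - nu (d j y) = - (mu (d j x) - nu (d j x)) +
     ((mu (d j x) - mu (d j y)) + (mu (d j y) - nu (d j y))) by ring.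
  have := cabsD (- (mu (d j x) - nu (d j x)))
     ((mu (d j x) - mu (d j y)) + (mu (d j y) - nu (d j y))).
  have := cabsD (mu (d j x) - mu (d j y)) (mu (d j y) - nu (d j y)).
  rewrite cabsN etaE; lra.
have Pxy : PX (x - y).
  by case: Sx Sy => Px _ [Py _]; apply: PXD => //; exact: PXN.
(* The frame identity is inserted in the second argument only. *)
have ipE : ip (x - y) (x - y) = \sum_(j < n) star (d j (x - y)) * d j (x - y).
  rewrite -{2}(frame _ Pxy).
  have ip0 z : ip z 0 = 0 by rewrite -(scale0r z) ipZr scale0r.
  rewrite (big_morph (ip (x - y)) (ipDr _) (ip0 _)); apply: eq_bigr => j _.
  by case: HX => _ _ -> -> _.
have nrm_sum : nrmA (ip (x - y) (x - y)) <= \sum_(j < n) (2 * eta) ^+ 2.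
  rewrite ipE; elim/big_ind2: _ => [|a u b v|j _].
  - case: HA => _ [_ _ _ nZ] _ _ _.
    by rewrite -(scale0r (0 : A0)) nZ /cabs Normc.normc0 mul0r.
  - by case: HA => _ [_ _ nD _] _ _ _ => au bv; apply: le_trans (nD _ _) _; exact: lerD.
  case: HA => _ _ _ -> _.
  by rewrite lerXn2r ?nnegrE ?mulr_ge0// ltW.
rewrite /hilbert_module_norm -(@ltr_pXn2r _ 2)// ?nnegrE ?sqrtr_ge0 ?(ltW e0)//.
rewrite sqr_sqrtr//; apply: le_lt_trans nrm_sum _.
have eE : e = 2 * eta * n.+1%:R.
  by rewrite mulrAC [RHS]mulrC divfK// gt_eqF// mulr_gt0// ltr0n.
rewrite sumr_const card_ord eE [(_ * _.+1%:R) ^+ 2]exprMn -[_ *+ n]mulr_natr.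
rewrite ltr_pM2l; last by rewrite exprn_gt0// mulr_gt0.
by rewrite -natrX ltr_nat expnS expn1 leq_pmulr.
Qed.
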